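(* Let $\mathfrak{m}$ and $\mathfrak{n}$ be finitely generated Leibniz algebras over a field $\mathbb{K}$ acting on each other compatibly. Then the non-abelian tensor product $\mathfrak{m}\star\mathfrak{n}$ is a finitely generated Leibniz algebra if and only if $\tau_{\mathfrak{m}}(\mathfrak{m}\star\mathfrak{n})$ and $\tau_{\mathfrak{n}}(\mathfrak{m}\star\mathfrak{n})$ are finitely generated Leibniz algebras.
   Context: $\mathbb{K}$ is a field. Leibniz algebras are right Leibniz algebras over $\mathbb{K}$: vector spaces with a bilinear bracket satisfying $[x,[y,z]]=[[x,y],z]-[[x,z],y]$. ''Finitely generated'' means finitely generated as a Leibniz algebra. Leibniz action. A Leibniz action of $\mathfrak{m}$ on $\mathfrak{n}$ is a pair of bilinear maps $\mathfrak{m}\times\mathfrak{n}\to\mathfrak{n}$, $(m,n)\mapsto {}^mn$, and $\mathfrak{n}\times\mathfrak{m}\to\mathfrak{n}$, $(n,m)\mapsto n^m$, such that for all $m,m'\in\mathfrak{m}$, $n,n'\in\mathfrak{n}$: ${}^{[m,m']}n={}^m({}^{m'}n)+({}^mn)^{m'}$; ${}^m[n,n']=[{}^mn,n']-[{}^mn',n]$; $n^{[m,m']}=(n^m)^{m'}-(n^{m'})^m$; $[n,n']^m=[n^m,n']+[n,n'^m]$; ${}^m({}^{m'}n)=-{}^m(n^{m'})$; $[n,{}^mn']=-[n,n'^m]$. Compatibility. Suppose $\mathfrak{m}$ and $\mathfrak{n}$ act on each other (so ${}^mn,n^m\in\mathfrak{n}$ and ${}^nm,m^n\in\mathfrak{m}$).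 The actions are compatible if for all $m,m'\in\mathfrak{m}$, $n,n'\in\mathfrak{n}$: ${}^{({}^mn)}m'=[m^n,m']$; ${}^{({}^nm)}n'=[n^m,n']$; ${}^{(n^m)}m'=[{}^nm,m']$; ${}^{(m^n)}n'=[{}^mn,n']$; $m^{({}^{m'}n)}=[m,m'^n]$; $n^{({}^{n'}m)}=[n,n'^m]$; $m^{(n^{m'})}=[m,{}^nm']$; $n^{(m^{n'})}=[n,{}^mn']$. Non-abelian tensor product. $\mathfrak{m}\star\mathfrak{n}$ is the Leibniz algebra generated by symbols $m*n$ and $n*m$ ($m\in\mathfrak{m}$, $n\in\mathfrak{n}$) subject to the following relations, for all $k\in\mathbb{K}$, $m,m'\in\mathfrak{m}$, $n,n'\in\mathfrak{n}$: (1) $k(m*n)=km*n=m*kn$; $k(n*m)=kn*m=n*km$. (2) $(m+m')*n=m*n+m'*n$; $(n+n')*m=n*m+n'*m$; $m*(n+n')=m*n+m*n'$; $n*(m+m')=n*m+n*m'$. (3) $m*[n,n']=m^n*n'-m^{n'}*n$; $n*[m,m']=n^m*m'-n^{m'}*m$; $[m,m']*n={}^mn*m'-m*n^{m'}$; $[n,n']*m={}^nm*n'-n*m^{n'}$. (4) $m*{}^{m'}n=-m*n^{m'}$; $n*{}^{n'}m=-n*m^{n'}$. (5) $m^n*{}^{m'}n'=[m*n,m'*n']={}^mn*m'^{n'}$; ${}^nm*n'^{m'}=[n*m,n'*m']=n^m*{}^{n'}m'$; $m^n*n'^{m'}=[m*n,n'*m']={}^mn*{}^{n'}m'$; ${}^nm*{}^{m'}n'=[n*m,m'*n']=n^m*m'^{n'}$.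 There are induced Leibniz homomorphisms $\tau_{\mathfrak{m}}\colon\mathfrak{m}\star\mathfrak{n}\to\mathfrak{m}$ with $\tau_{\mathfrak{m}}(m*n)=m^n$, $\tau_{\mathfrak{m}}(n*m)={}^nm$, and $\tau_{\mathfrak{n}}\colon\mathfrak{m}\star\mathfrak{n}\to\mathfrak{n}$ with $\tau_{\mathfrak{n}}(m*n)={}^mn$, $\tau_{\mathfrak{n}}(n*m)=n^m$. *)

(* Defs.v *)
From HB Require Import structures.
From mathcomp Require Import all_boot all_algebra sesquilinear.
From mathcomp Require Import generic_quotient.
From mathcomp Require Import boolp classical_sets.

Set Implicit Arguments.
Unset Strict Implicit.
Unset Printing Implicit Defensive.

Import GRing.Theory.
Local Open Scope ring_scope.
Local Open Scope classical_set_scope.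
Local Open Scope quotient_scope.

HB.mixin Record Lmodule_isLeibniz (K : fieldType) V of GRing.Lmodule K V := {
  lbr : V -> V -> V;
  lbr_bilinear : bilinear_for *:%R *:%R lbr;
  lbr_leibniz : forall x y z,
    lbr x (lbr y z) = lbr (lbr x y) z - lbr (lbr x z) y
}.

#[short(type="leibnizType")]
HB.structure Definition Leibniz (K : fieldType) :=
  {V of GRing.Lmodule K V & Lmodule_isLeibniz K V}.

Notation "[< x , y >]" := (lbr x y) (at level 0, x at level 99, y at level 99,
  format "[<  x ,  y  >]") : ring_scope.

Section Generation.
Variables (K : fieldType) (L : leibnizType K).

Definition leibniz_subalgebra (S : set L) : Prop :=
  [/\ S 0,
      forall k x y, S x -> S y -> S (k *: x + y)
    & forall x y, S x -> S y -> S [< x, y >]].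

Definition generated_subalgebra (A : set L) : set L :=
  smallest leibniz_subalgebra A.

(* For a subalgebra S: S is finitely generated as a Leibniz algebra.  The
   generators automatically lie in S. *)
Definition finitely_generated (S : set L) : Prop :=
  exists s : seq L, S = generated_subalgebra [set` s].

End Generation.

Definition leibniz_morphism (K : fieldType) (L L' : leibnizType K)
    (f : L -> L') : Prop :=
  linear f /\ forall x y, f [< x, y >] = [< f x, f y >].

(* [actl a m n] is {}^m n and [actr a n m] is n^m. *)
Record leibniz_action (K : fieldType) (M N : leibnizType K) := LeibnizAction {
  actl : M -> N -> N;
  actr : N -> M -> N;
  actl_bilinear : bilinear_for *:%R *:%R actl;
  actr_bilinear : bilinear_for *:%R *:%R actr;
  actl_lbr : forall m m' n,
    actl [< m, m' >] n = actl m (actl m' n) + actr (actl m n) m';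
  lbr_actl : forall m n n',
    actl m [< n, n' >] = [< actl m n, n' >] - [< actl m n', n >];
  actr_lbr : forall m m' n,
    actr n [< m, m' >] = actr (actr n m) m' - actr (actr n m') m;
  lbr_actr : forall m n n',
    actr [< n, n' >] m = [< actr n m, n' >] + [< n, actr n' m >];
  actl_actl : forall m m' n, actl m (actl m' n) = - actl m (actr n m');
  lbr_actlr : forall m n n', [< n, actl m n' >] = - [< n, actr n' m >]
}.

(* [a] is the action of M on N, [b] the action of N on M. *)
Record compatible (K : fieldType) (M N : leibnizType K)
    (a : leibniz_action M N) (b : leibniz_action N M) : Prop := Compatible {
  compat_ll_M : forall m m' n,
    actl b (actl a m n) m' = [< actr b m n, m' >];
  compat_ll_N : forall m n n',
    actl a (actl b n m) n' = [< actr a n m, n' >];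
  compat_lr_M : forall m m' n,
    actl b (actr a n m) m' = [< actl b n m, m' >];
  compat_lr_N : forall m n n',
    actl a (actr b m n) n' = [< actl a m n, n' >];
  compat_rl_M : forall m m' n,
    actr b m (actl a m' n) = [< m, actr b m' n >];
  compat_rl_N : forall m n n',
    actr a n (actl b n' m) = [< n, actr a n' m >];
  compat_rr_M : forall m m' n,
    actr b m (actr a n m') = [< m, actl b n m' >];
  compat_rr_N : forall m n n',
    actr a n (actr b m n') = [< n, actl a m n' >]
}.

Inductive leibniz_term (K : fieldType) (G : Type) :=
| LGen of G
| LZero
| LAdd of leibniz_term K G & leibniz_term K G
| LOpp of leibniz_term K G
| LScale of K & leibniz_term K G
| LBr of leibniz_term K G & leibniz_term K G.
Arguments LGen {K G}.
Arguments LZero {K G}.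

HB.instance Definition _ (K : fieldType) (G : Type) :=
  gen_eqMixin (leibniz_term K G).
HB.instance Definition _ (K : fieldType) (G : Type) :=
  gen_choiceMixin (leibniz_term K G).

(* The Leibniz K-algebra presented by the generators G and the relations
   [x = y] for [R x y]: terms modulo the least congruence that contains R and
   the Leibniz algebra axioms. *)
Section Presentation.
Variables (K : fieldType) (G : Type).
Local Notation term := (leibniz_term K G).
Variable R : term -> term -> Prop.

Inductive pres_cong : term -> term -> Prop :=
| cong_rel x y of R x y : pres_cong x y
| cong_refl x : pres_cong x x
| cong_sym x y of pres_cong x y : pres_cong y x
| cong_trans x y z of pres_cong x y & pres_cong y z : pres_cong x z
| cong_add x x' y y' of pres_cong x x' & pres_cong y y' :
    pres_cong (LAdd x y) (LAdd x' y')
| cong_opp x x' of pres_cong x x' : pres_cong (LOpp x) (LOpp x')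
| cong_scale k x x' of pres_cong x x' : pres_cong (LScale k x) (LScale k x')
| cong_br x x' y y' of pres_cong x x' & pres_cong y y' :
    pres_cong (LBr x y) (LBr x' y')
| cong_addA x y z : pres_cong (LAdd x (LAdd y z)) (LAdd (LAdd x y) z)
| cong_addC x y : pres_cong (LAdd x y) (LAdd y x)
| cong_add0 x : pres_cong (LAdd LZero x) x
| cong_addN x : pres_cong (LAdd (LOpp x) x) LZero
| cong_scaleA k l x : pres_cong (LScale k (LScale l x)) (LScale (k * l) x)
| cong_scale1 x : pres_cong (LScale 1 x) x
| cong_scaleDr k x y :
    pres_cong (LScale k (LAdd x y)) (LAdd (LScale k x) (LScale k y))
| cong_scaleDl k l x :
    pres_cong (LScale (k + l) x) (LAdd (LScale k x) (LScale l x))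
| cong_br_linl k x x' y :
    pres_cong (LBr (LAdd (LScale k x) x') y)
              (LAdd (LScale k (LBr x y)) (LBr x' y))
| cong_br_linr k x y y' :
    pres_cong (LBr x (LAdd (LScale k y) y'))
              (LAdd (LScale k (LBr x y)) (LBr x y'))
| cong_leibniz x y z :
    pres_cong (LBr x (LBr y z))
              (LAdd (LBr (LBr x y) z) (LOpp (LBr (LBr x z) y))).

Definition pres_congb (x y : term) : bool := `[< pres_cong x y >].

Lemma pres_congb_refl : reflexive pres_congb.
Proof. by move=> x; apply/asboolP/cong_refl. Qed.

Lemma pres_congb_sym : symmetric pres_congb.
Proof. by move=> x y; apply/asboolP/asboolP => /cong_sym. Qed.

Lemma pres_congb_trans : transitive pres_congb.
Proof.
by move=> y x z /asboolP xy /asboolP yz; apply/asboolP/(cong_trans xy yz).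
Qed.

Canonical pres_equiv :=
  EquivRel pres_congb pres_congb_refl pres_congb_sym pres_congb_trans.

Definition presented : Type := {eq_quot pres_equiv}.

HB.instance Definition _ := Choice.on presented.

Definition pres_class (x : term) : presented := \pi_({eq_quot pres_equiv}) x.
Definition pres_repr (u : presented) : term :=
  repr (u : {eq_quot pres_equiv}).
Definition pres_gen (g : G) : presented := pres_class (LGen g).

Lemma pres_reprK u : pres_class (pres_repr u) = u.
Proof. exact: reprK. Qed.

Lemma pres_classP x y : pres_class x = pres_class y <-> pres_cong x y.
Proof.
split=> [/eqmodP/asboolP //|xy].
by apply/eqmodP/asboolP.
Qed.

Lemma pres_class_repr x : pres_cong (pres_repr (pres_class x)) x.
Proof. by apply/pres_classP; rewrite pres_reprK. Qed.

Let add (u v : presented) := pres_class (LAdd (pres_repr u) (pres_repr v)).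
Let opp (u : presented) := pres_class (LOpp (pres_repr u)).
Let scale (k : K) (u : presented) := pres_class (LScale k (pres_repr u)).
Let br (u v : presented) := pres_class (LBr (pres_repr u) (pres_repr v)).

Let addE x y : add (pres_class x) (pres_class y) = pres_class (LAdd x y).
Proof. by apply/pres_classP/cong_add; apply: pres_class_repr. Qed.
Let oppE x : opp (pres_class x) = pres_class (LOpp x).
Proof. by apply/pres_classP/cong_opp/pres_class_repr. Qed.
Let scaleE k x : scale k (pres_class x) = pres_class (LScale k x).
Proof. by apply/pres_classP/cong_scale/pres_class_repr. Qed.
Let brE x y : br (pres_class x) (pres_class y) = pres_class (LBr x y).
Proof. by apply/pres_classP/cong_br; apply: pres_class_repr. Qed.

Let addA : associative add.
Proof.
move=> u v w; rewrite -[u]pres_reprK -[v]pres_reprK -[w]pres_reprK !addE.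
exact/pres_classP/cong_addA.
Qed.
Let addC : commutative add.
Proof. by move=> u v; apply/pres_classP/cong_addC. Qed.
Let add0 : left_id (pres_class LZero) add.
Proof.
move=> u; rewrite -[u]pres_reprK !addE.
exact/pres_classP/cong_add0.
Qed.
Let addN : left_inverse (pres_class LZero) opp add.
Proof.
move=> u; rewrite -[u]pres_reprK oppE !addE.
exact/pres_classP/cong_addN.
Qed.

HB.instance Definition _ := GRing.isZmodule.Build presented addA addC add0 addN.

Let scaleA k l u : scale k (scale l u) = scale (k * l) u.
Proof.
rewrite -[u]pres_reprK !scaleE.
exact/pres_classP/cong_scaleA.
Qed.
Let scale1 : left_id 1 scale.
Proof.
move=> u; rewrite -[u]pres_reprK !scaleE.
exact/pres_classP/cong_scale1.
Qed.
Let scaleDr : right_distributive scale +%R.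
Proof.
move=> k u v; rewrite -[u]pres_reprK -[v]pres_reprK.
rewrite -[_ + _ in LHS]/(add _ _) -[RHS]/(add _ _) !(addE, scaleE).
exact/pres_classP/cong_scaleDr.
Qed.
Let scaleDl u : {morph scale^~ u : k l / k + l}.
Proof.
move=> k l; rewrite -[u]pres_reprK !scaleE [RHS]addE.
exact/pres_classP/cong_scaleDl.
Qed.

HB.instance Definition _ :=
  GRing.Zmodule_isLmodule.Build K presented scaleA scale1 scaleDr scaleDl.

Lemma pres_class0 : pres_class LZero = 0.
Proof. by []. Qed.
Lemma pres_classD x y : pres_class (LAdd x y) = pres_class x + pres_class y.
Proof. by rewrite -addE. Qed.
Lemma pres_classN x : pres_class (LOpp x) = - pres_class x.
Proof. by rewrite -oppE. Qed.
Lemma pres_classZ k x : pres_class (LScale k x) = k *: pres_class x.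
Proof. by rewrite -scaleE. Qed.

Let br_bilinear : bilinear_for *:%R *:%R br.
Proof.
split=> [v k u w | u k v w] /=;
  rewrite -[u]pres_reprK -[v]pres_reprK -[w]pres_reprK.
- rewrite -(pres_classZ k (pres_repr u)) -(pres_classD (LScale _ _)) !brE.
  rewrite -pres_classZ -pres_classD.
  exact/pres_classP/cong_br_linl.
- rewrite -(pres_classZ k (pres_repr v)) -(pres_classD (LScale _ _)) !brE.
  rewrite -pres_classZ -pres_classD.
  exact/pres_classP/cong_br_linr.
Qed.

Let br_leibniz u v w : br u (br v w) = br (br u v) w - br (br u w) v.
Proof.
rewrite -[u]pres_reprK -[v]pres_reprK -[w]pres_reprK !brE.
rewrite -pres_classN -pres_classD.
exact/pres_classP/cong_leibniz.
Qed.

HB.instance Definition _ :=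
  Lmodule_isLeibniz.Build K presented br_bilinear br_leibniz.

Lemma pres_class_br x y :
  pres_class (LBr x y) = [< pres_class x, pres_class y >].
Proof. by rewrite -brE. Qed.

Lemma pres_rel x y : R x y -> pres_class x = pres_class y.
Proof. by move=> Rxy; apply/pres_classP/cong_rel. Qed.

Section Lift.
Variables (L : leibnizType K) (f : G -> L).

Fixpoint term_eval (x : term) : L :=
  match x with
  | LGen g => f g
  | LZero => 0
  | LAdd x y => term_eval x + term_eval y
  | LOpp x => - term_eval x
  | LScale k x => k *: term_eval x
  | LBr x y => [< term_eval x, term_eval y >]
  end.

Hypothesis fR : forall x y, R x y -> term_eval x = term_eval y.

Lemma term_eval_cong x y : pres_cong x y -> term_eval x = term_eval y.
Proof.
have [lbrl lbrr] := @lbr_bilinear K L.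
elim=> {x y} /=; try by move=> *; congruence.
- exact: fR.
- by move=> *; rewrite addrA.
- by move=> *; rewrite addrC.
- by move=> *; rewrite add0r.
- by move=> *; rewrite addNr.
- by move=> *; rewrite scalerA.
- by move=> *; rewrite scale1r.
- by move=> *; rewrite scalerDr.
- by move=> *; rewrite scalerDl.
- by move=> k x x' y; apply: lbrl.
- by move=> k x y y'; apply: lbrr.
- by move=> *; apply: lbr_leibniz.
Qed.

End Lift.

(* The homomorphism induced on the presented algebra by a map on generators
   that satisfies the relations. *)
Definition pres_lift (L : leibnizType K) (f : G -> L)
    of (forall x y, R x y -> term_eval f x = term_eval f y) :=
  fun u : presented => term_eval f (pres_repr u).

Section LiftTheory.
Variables (L : leibnizType K) (f : G -> L).
Hypothesis fR : forall x y, R x y -> term_eval f x = term_eval f y.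

Lemma pres_lift_class x : pres_lift fR (pres_class x) = term_eval f x.
Proof. exact: (term_eval_cong fR (pres_class_repr x)). Qed.

Lemma pres_lift_gen g : pres_lift fR (pres_gen g) = f g.
Proof. exact: pres_lift_class. Qed.

Lemma pres_lift_morphism : leibniz_morphism (pres_lift fR).
Proof.
split=> [k u v | u v]; rewrite -[u]pres_reprK -[v]pres_reprK.
- by rewrite -pres_classZ -pres_classD !pres_lift_class.
- by rewrite -pres_class_br !pres_lift_class.
Qed.

End LiftTheory.

End Presentation.

(* [TMN m n] is the symbol m * n and [TNM n m] the symbol n * m; they are
   different symbols even when M and N coincide. *)
Inductive tensor_symbol (M N : Type) :=
| TMN of M & N
| TNM of N & M.
Arguments TMN {M N}.
Arguments TNM {M N}.

Section Tensor.
Variables (K : fieldType) (M N : leibnizType K).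
Variables (a : leibniz_action M N) (b : leibniz_action N M).

Local Notation term := (leibniz_term K (tensor_symbol M N)).
Local Notation "m *> n" := (LGen (TMN m n)) (at level 40).
Local Notation "n <* m" := (LGen (TNM n m)) (at level 40).
Local Notation "x -- y" := (LAdd x (LOpp y)) (at level 50).

Inductive tensor_rel : term -> term -> Prop :=
| tr_scale_mn_l k m n : tensor_rel (LScale k (m *> n)) ((k *: m) *> n)
| tr_scale_mn_r k m n : tensor_rel (LScale k (m *> n)) (m *> (k *: n))
| tr_scale_nm_l k m n : tensor_rel (LScale k (n <* m)) ((k *: n) <* m)
| tr_scale_nm_r k m n : tensor_rel (LScale k (n <* m)) (n <* (k *: m))
| tr_add_mn_l m m' n : tensor_rel ((m + m') *> n) (LAdd (m *> n) (m' *> n))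
| tr_add_nm_l m n n' : tensor_rel ((n + n') <* m) (LAdd (n <* m) (n' <* m))
| tr_add_mn_r m n n' : tensor_rel (m *> (n + n')) (LAdd (m *> n) (m *> n'))
| tr_add_nm_r m m' n : tensor_rel (n <* (m + m')) (LAdd (n <* m) (n <* m'))
| tr_br_mn_r m n n' :
    tensor_rel (m *> [< n, n' >]) ((actr b m n *> n') -- (actr b m n' *> n))
| tr_br_nm_r m m' n :
    tensor_rel (n <* [< m, m' >]) ((actr a n m <* m') -- (actr a n m' <* m))
| tr_br_mn_l m m' n :
    tensor_rel ([< m, m' >] *> n) ((actl a m n <* m') -- (m *> actr a n m'))
| tr_br_nm_l m n n' :
    tensor_rel ([< n, n' >] <* m) ((actl b n m *> n') -- (n <* actr b m n'))
| tr_act_mn m m' n : tensor_rel (m *> actl a m' n) (LOpp (m *> actr a n m'))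
| tr_act_nm m n n' : tensor_rel (n <* actl b n' m) (LOpp (n <* actr b m n'))
| tr_mn_mn_1 m m' n n' :
    tensor_rel (actr b m n *> actl a m' n') (LBr (m *> n) (m' *> n'))
| tr_mn_mn_2 m m' n n' :
    tensor_rel (LBr (m *> n) (m' *> n')) (actl a m n <* actr b m' n')
| tr_nm_nm_1 m m' n n' :
    tensor_rel (actl b n m *> actr a n' m') (LBr (n <* m) (n' <* m'))
| tr_nm_nm_2 m m' n n' :
    tensor_rel (LBr (n <* m) (n' <* m')) (actr a n m <* actl b n' m')
| tr_mn_nm_1 m m' n n' :
    tensor_rel (actr b m n *> actr a n' m') (LBr (m *> n) (n' <* m'))
| tr_mn_nm_2 m m' n n' :
    tensor_rel (LBr (m *> n) (n' <* m')) (actl a m n <* actl b n' m')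
| tr_nm_mn_1 m m' n n' :
    tensor_rel (actl b n m *> actl a m' n') (LBr (n <* m) (m' *> n'))
| tr_nm_mn_2 m m' n n' :
    tensor_rel (LBr (n <* m) (m' *> n')) (actr a n m <* actr b m' n').

Definition tensor : leibnizType K := presented tensor_rel.

Definition tensor_mn (m : M) (n : N) : tensor := pres_gen tensor_rel (TMN m n).
Definition tensor_nm (n : N) (m : M) : tensor := pres_gen tensor_rel (TNM n m).

Definition tau_M_symbol (t : tensor_symbol M N) : M :=
  match t with TMN m n => actr b m n | TNM n m => actl b n m end.
Definition tau_N_symbol (t : tensor_symbol M N) : N :=
  match t with TMN m n => actl a m n | TNM n m => actr a n m end.

End Tensor.

Section BilinearE.
Variables (K : fieldType) (U V W : lmodType K) (f : U -> V -> W).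
Hypothesis f_bilin : bilinear_for *:%R *:%R f.

Let bilin_addl x y z : f (x + y) z = f x z + f y z.
Proof. by have /= := f_bilin.1 z 1 x y; rewrite !scale1r. Qed.
Let bilin_addr x y z : f x (y + z) = f x y + f x z.
Proof. by have /= := f_bilin.2 x 1 y z; rewrite !scale1r. Qed.
Let bilin_scalel k x z : f (k *: x) z = k *: f x z.
Proof.
have f0 : f 0 z = 0 by apply: (addrI (f 0 z)); rewrite -bilin_addl !addr0.
by have /= := f_bilin.1 z k x 0; rewrite f0 !addr0.
Qed.
Let bilin_scaler k x z : f x (k *: z) = k *: f x z.
Proof.
have f0 : f x 0 = 0 by apply: (addrI (f x 0)); rewrite -bilin_addr !addr0.
by have /= := f_bilin.2 x k z 0; rewrite f0 !addr0.
Qed.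

Definition bilinE := (bilin_addl, bilin_addr, bilin_scalel, bilin_scaler).

End BilinearE.

Section Tau.
Variables (K : fieldType) (M N : leibnizType K).
Variables (a : leibniz_action M N) (b : leibniz_action N M).
Hypothesis ab : compatible a b.

Lemma tau_M_rel x y : tensor_rel a b x y ->
  term_eval (tau_M_symbol b) x = term_eval (tau_M_symbol b) y.
Proof.
have [cM1 _ cM2 _ cM3 _ cM4 _] := ab.
case=> * /=;
  rewrite ?(bilinE (actl_bilinear b)) ?(bilinE (actr_bilinear b)) //;
  rewrite ?cM1 ?cM2 ?cM3 ?cM4 ?lbr_actl ?actr_lbr ?lbr_actr ?actl_lbr
    ?lbr_actlr ?opprK //.
- by rewrite actl_actl addrC.
- by rewrite actl_actl.
Qed.

Lemma tau_N_rel x y : tensor_rel a b x y ->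
  term_eval (tau_N_symbol a) x = term_eval (tau_N_symbol a) y.
Proof.
have [_ cN1 _ cN2 _ cN3 _ cN4] := ab.
case=> * /=;
  rewrite ?(bilinE (actl_bilinear a)) ?(bilinE (actr_bilinear a)) //;
  rewrite ?cN1 ?cN2 ?cN3 ?cN4 ?lbr_actl ?actr_lbr ?lbr_actr ?actl_lbr
    ?lbr_actlr ?opprK //.
- by rewrite actl_actl addrC.
- by rewrite actl_actl.
Qed.

Definition tau_M : tensor a b -> M := pres_lift tau_M_rel.
Definition tau_N : tensor a b -> N := pres_lift tau_N_rel.

Lemma tau_M_mn m n : tau_M (tensor_mn a b m n) = actr b m n.
Proof. exact: pres_lift_gen. Qed.
Lemma tau_M_nm n m : tau_M (tensor_nm a b n m) = actl b n m.
Proof. exact: pres_lift_gen. Qed.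
Lemma tau_N_mn m n : tau_N (tensor_mn a b m n) = actl a m n.
Proof. exact: pres_lift_gen. Qed.
Lemma tau_N_nm n m : tau_N (tensor_nm a b n m) = actr a n m.
Proof. exact: pres_lift_gen. Qed.

Lemma tau_M_morphism : leibniz_morphism tau_M.
Proof. exact: pres_lift_morphism. Qed.
Lemma tau_N_morphism : leibniz_morphism tau_N.
Proof. exact: pres_lift_morphism. Qed.

End Tau.

(* Main.v *)
Require Import Defs.
From mathcomp Require Import all_boot all_algebra.
From mathcomp Require Import boolp classical_sets.

(** Write [T] for the tensor product and [DM], [DN] for the images of [tau_M]
and [tau_N].  One direction is the fact that a homomorphic image of a finitely
generated algebra is finitely generated.

For the converse, the defining relations of [T] make the bracket of two symbols
a symbol again, so the symbols span [T] linearly ([tensor_span]).  By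
bilinearity, these relations extend from symbols to all of [T]:
  [[t, t'] = tau_M t * tau_N t' = tau_N t * tau_M t']
([tensor_br_mn], [tensor_br_nm]).  In particular a bracket depends on each of
its arguments only through the image under [tau_M]: the kernel of [tau_M] is
central.  Hence, as soon as a subalgebra [S] of [T] contains preimages of a
finite set of generators of [DM], it maps onto [DM] and contains [[T, T]], which
is the span of [DM * DN] and also of [DN * DM] ([sub_tensor_br]).

It remains to see that [T] is finite dimensional modulo [[T, T]], and here the
relations that expand a symbol with a bracket as one of its entries suffice
([pairing_generated]).  Let [X], [Y], [E] be finite sets of generators of [M],
[N] and [DN].  Modulo [[T, T]], each of the following spaces is spanned by
finitely many symbols, because such a relation expresses a symbol by symbols
that lie in [[T, T]], or in a space that comes earlier in the list, or that have
a shorter entry in place of the bracket: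
  [DN * X] by [E * X],   then [DN * M] by [DN * X],
  [X * DN] by [X * E],   then [M * DN] by [DN * M] and [X * DN],
  [M * Y] by [DN * M], [M * DN] and [X * Y],   then [M * N] by [M * Y].
Exchanging the roles of [M] and [N] gives the same for [N * M]. *)

Set Implicit Arguments.
Unset Strict Implicit.
Unset Printing Implicit Defensive.

Import GRing.Theory.
Local Open Scope ring_scope.
Local Open Scope classical_set_scope.

(** * Linear spans *)

Section LinearSpan.
Variable K : fieldType.

Definition linear_subspace (V : lmodType K) (S : set V) : Prop :=
  S 0 /\ forall k x y, S x -> S y -> S (k *: x + y).

Definition linear_span (V : lmodType K) (A : set V) : set V :=
  smallest (@linear_subspace V) A.

Lemma linear_subspaceB (V : lmodType K) (S : set V) x y :
  linear_subspace S -> S x -> S y -> S (x - y).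
Proof. by move=> [_ SD] Sx Sy; rewrite addrC -scaleN1r; apply: SD. Qed.

Lemma linear_span_subspace (V : lmodType K) (A : set V) :
  linear_subspace (linear_span A).
Proof.
split=> [S [[S0 _] _] // | k x y Ax Ay S SA].
by have [[_ SD] _] := SA; apply: SD; [apply: Ax | apply: Ay].
Qed.

Variables U V W : lmodType K.

Lemma bilinear0l (f : U -> V -> W) y :
  bilinear_for *:%R *:%R f -> f 0 y = 0.
Proof. by move=> fB; rewrite -(scale0r 0) (bilinE fB) scale0r. Qed.

Lemma bilinear0r (f : U -> V -> W) x :
  bilinear_for *:%R *:%R f -> f x 0 = 0.
Proof. by move=> fB; rewrite -(scale0r 0) (bilinE fB) scale0r. Qed.

Lemma linear_subspace_preiml (f : U -> V -> W) (S : set W) y :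
  bilinear_for *:%R *:%R f -> linear_subspace S ->
  linear_subspace [set x | S (f x y)].
Proof.
move=> fB [S0 SD]; split=> [|k x x' /= Sx Sx']; first by rewrite /= bilinear0l.
by rewrite !(bilinE fB); apply: SD.
Qed.

Lemma linear_subspace_preimr (f : U -> V -> W) (S : set W) x :
  bilinear_for *:%R *:%R f -> linear_subspace S ->
  linear_subspace [set y | S (f x y)].
Proof.
move=> fB [S0 SD]; split=> [|k y y' /= Sy Sy']; first by rewrite /= bilinear0r.
by rewrite !(bilinE fB); apply: SD.
Qed.

Lemma bilinear_eq_span (f g : U -> V -> W) (A : set U) (B : set V) :
    bilinear_for *:%R *:%R f -> bilinear_for *:%R *:%R g ->
    (forall x y, A x -> B y -> f x y = g x y) ->
  forall x y, linear_span A x -> linear_span B y -> f x y = g x y.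
Proof.
move=> fB gB fg x y Ax By.
suff fgA x' : A x' -> f x' y = g x' y.
  apply: (Ax [set x' | f x' y = g x' y]); split=> //.
  split=> [|k u v /= eu ev]; first by rewrite /= !bilinear0l.
  by rewrite !(bilinE fB) !(bilinE gB) eu ev.
move=> Ax'; apply: (By [set y' | f x' y' = g x' y']).
split=> [|y' By']; last exact: fg.
split=> [|k u v /= eu ev]; first by rewrite /= !bilinear0r.
by rewrite !(bilinE fB) !(bilinE gB) eu ev.
Qed.

End LinearSpan.

(** * Subalgebras and homomorphisms *)

Section Subalgebras.
Variable K : fieldType.

Lemma leibniz_subalgebra_linear (L : leibnizType K) (S : set L) :
  leibniz_subalgebra S -> linear_subspace S.
Proof. by case. Qed.

Lemma generated_subalgebraP (L : leibnizType K) (A : set L) :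
  leibniz_subalgebra (generated_subalgebra A).
Proof.
split=> [S [[]] // | k x y Ax Ay S SA | x y Ax Ay S SA];
  have [[_ SD SB] _] := SA.
- by apply: SD; [apply: Ax | apply: Ay].
- by apply: SB; [apply: Ax | apply: Ay].
Qed.

Lemma sub_generated (L : leibnizType K) (A : set L) x :
  A x -> generated_subalgebra A x.
Proof. by move=> Ax S [_]; apply. Qed.

Lemma generated_min (L : leibnizType K) (A S : set L) :
  leibniz_subalgebra S -> A `<=` S -> generated_subalgebra A `<=` S.
Proof. by move=> SL AS; apply: smallest_sub. Qed.

Lemma leibniz_subalgebraI (L : leibnizType K) (S S' : set L) :
  leibniz_subalgebra S -> linear_subspace S' ->
  (forall x y, S x -> S y -> S' x -> S' y -> S' [< x, y >]) ->
  leibniz_subalgebra (S `&` S').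
Proof.
move=> [S0 SD SB] [S'0 S'D] S'B; split=> //.
- by move=> k x y [Sx S'x] [Sy S'y]; split; [apply: SD | apply: S'D].
- by move=> x y [Sx S'x] [Sy S'y]; split; [apply: SB | apply: S'B].
Qed.

(** Fixing one argument at a time, the vectors that bracket into the span with
every generator form a subspace; so only brackets of generators matter. *)
Lemma linear_span_subalgebra (L : leibnizType K) (A : set L) :
  (forall x y, A x -> A y -> linear_span A [< x, y >]) ->
  leibniz_subalgebra (linear_span A).
Proof.
move=> AB; have [A0 AD] := linear_span_subspace A; split=> // x y Ax Ay.
have lB := @lbr_bilinear K L.
apply: (Ax [set x' | linear_span A [< x', y >]]); split.
  exact: linear_subspace_preiml lB (linear_span_subspace A).
move=> x' Ax'; apply: (Ay [set y' | linear_span A [< x', y' >]]); split.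
  exact: linear_subspace_preimr lB (linear_span_subspace A).
by move=> y' Ay'; apply: AB.
Qed.

Variables (L L' : leibnizType K) (f : L -> L').
Hypothesis f_morph : leibniz_morphism f.

Lemma leibniz_morphism0 : f 0 = 0.
Proof.
have [fL _] := f_morph; have := fL (-1) 0 0.
by rewrite scaler0 addr0 scaleN1r addNr.
Qed.

Lemma image_subalgebra (S : set L) :
  leibniz_subalgebra S -> leibniz_subalgebra (f @` S).
Proof.
have [fL fB] := f_morph => - [S0 SD SB]; split.
- by exists 0; rewrite ?leibniz_morphism0.
- move=> k _ _ [x Sx <-] [y Sy <-].
  by exists (k *: x + y); [apply: SD | apply: fL].
- by move=> _ _ [x Sx <-] [y Sy <-]; exists [< x, y >]; [apply: SB | apply: fB].
Qed.

Lemma preimage_subalgebra (S : set L') :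
  leibniz_subalgebra S -> leibniz_subalgebra (f @^-1` S).
Proof.
have [fL fB] := f_morph => - [S0 SD SB]; split.
- by rewrite /= leibniz_morphism0.
- by move=> k x y /= Sx Sy; rewrite fL; apply: SD.
- by move=> x y /= Sx Sy; rewrite fB; apply: SB.
Qed.

Lemma image_finitely_generated (S : set L) :
  finitely_generated S -> finitely_generated (f @` S).
Proof.
move=> [s ->]; exists (map f s); rewrite eqEsubset; split.
  apply/image_subP; apply: generated_min.
    exact: preimage_subalgebra (generated_subalgebraP _).
  by move=> x xs; apply: sub_generated; apply: map_f.
apply: generated_min; first exact/image_subalgebra/generated_subalgebraP.
by move=> _ /mapP[x xs ->]; exists x => //; apply: sub_generated.
Qed.

(** A finite list of generators of the image lifts to a finite list [s]; any
subalgebra that contains the lifts then maps onto the whole image. *)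
Lemma finitely_generated_lift :
  finitely_generated (range f) -> exists s : seq L,
    forall S, leibniz_subalgebra S -> [set` s] `<=` S -> range f `<=` f @` S.
Proof.
move=> [r fr]; have [s rE] : exists s : seq L, r = map f s.
  have {fr} : forall y, y \in r -> range f y.
    by move=> y yr; rewrite fr; apply: sub_generated.
  elim: r => [|y r IHr] fr; first by exists [::].
  have [x _ <-] := fr y (mem_head _ _).
  have [|s ->] := IHr; first by move=> z zr; apply: fr; rewrite inE zr orbT.
  by exists (x :: s).
exists s => S SL sS; rewrite fr; apply: generated_min.
  exact: image_subalgebra.
by move=> y /=; rewrite rE => /mapP[x xs ->]; exists x => //; apply: sS.
Qed.

End Subalgebras.

(** * Pairings that expand brackets in their entries *)

(** A linear image of the symbols of the tensor product, with [p m n] for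
[m * n] and [q n m] for [n * m].  Keeping the two maps abstract makes the notion
symmetric in [M] and [N]: exchanging them turns [tensor a b] into the merely
isomorphic [tensor b a], but leaves the target [T] of a pairing unchanged. *)
Record crossed_pairing (K : fieldType) (M N : leibnizType K)
    (a : leibniz_action M N) (b : leibniz_action N M) (T : lmodType K)
    (p : M -> N -> T) (q : N -> M -> T) : Prop := CrossedPairing {
  pairing_p_bilinear : bilinear_for *:%R *:%R p;
  pairing_q_bilinear : bilinear_for *:%R *:%R q;
  pairing_p_brr : forall m n n',
    p m [< n, n' >] = p (actr b m n) n' - p (actr b m n') n;
  pairing_q_brr : forall m m' n,
    q n [< m, m' >] = q (actr a n m) m' - q (actr a n m') m;
  pairing_p_brl : forall m m' n,
    p [< m, m' >] n = q (actl a m n) m' - p m (actr a n m');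
  pairing_q_brl : forall m n n',
    q [< n, n' >] m = p (actl b n m) n' - q n (actr b m n')
}.

Lemma crossed_pairing_swap (K : fieldType) (M N : leibnizType K)
    (a : leibniz_action M N) (b : leibniz_action N M) (T : lmodType K)
    (p : M -> N -> T) (q : N -> M -> T) :
  crossed_pairing a b p q -> crossed_pairing b a q p.
Proof. by case. Qed.

(** The four bracket relations make the sets of entries whose symbols lie in [S]
closed under brackets, so that it is enough to test generators.  The order
matters: expanding [p [m, m'] n] produces a value of [q] at an entry of [DN], so
[q] on [DN] and [M] has to be settled before [p].  In the application, [DM] and
[DN] are the images of [tau_M] and [tau_N], and [S] is a subalgebra of the
tensor product that contains all brackets. *)
Lemma pairing_generated (K : fieldType) (M N : leibnizType K)
    (a : leibniz_action M N) (b : leibniz_action N M) (T : lmodType K)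
    (p : M -> N -> T) (q : N -> M -> T)
    (DM X : set M) (DN E Y : set N) (S : set T) :
    crossed_pairing a b p q -> linear_subspace S ->
    (forall n m, DM (actl b n m)) -> (forall m n, DM (actr b m n)) ->
    (forall m n, DN (actl a m n)) -> (forall n m, DN (actr a n m)) ->
    (forall m n, DM m -> DN n -> S (p m n)) ->
    (forall m n, DM m -> DN n -> S (q n m)) ->
    [set: M] = generated_subalgebra X -> [set: N] = generated_subalgebra Y ->
    DN = generated_subalgebra E ->
    (forall e x, E e -> X x -> S (q e x)) ->
    (forall x e, X x -> E e -> S (p x e)) ->
    (forall x y, X x -> Y y -> S (p x y)) ->
  forall m n, S (p m n).
Proof.
move=> [pB qB p_brr q_brr p_brl q_brl] SL DMl DMr DNl DNr Sp Sq MX NY DNE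
  Sex Sxe Sxy.
have DNalg : leibniz_subalgebra DN by rewrite DNE; apply: generated_subalgebraP.
have indM (P : set M) : linear_subspace P -> X `<=` P ->
    (forall m m', P m -> P m' -> P [< m, m' >]) -> forall m, P m.
  move=> [P0 PD] XP PBr m; suff: generated_subalgebra X `<=` P.
    by apply; rewrite -MX.
  exact: generated_min.
have indN (P : set N) : linear_subspace P -> Y `<=` P ->
    (forall n n', P n -> P n' -> P [< n, n' >]) -> forall n, P n.
  move=> [P0 PD] YP PBr n; suff: generated_subalgebra Y `<=` P.
    by apply; rewrite -NY.
  exact: generated_min.
have indDN (P : set N) : linear_subspace P -> E `<=` P ->
    (forall n n', DN n -> DN n' -> P [< n, n' >]) -> forall n, DN n -> P n.
  move=> PL EP PBr n; rewrite DNE => En.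
  suff: generated_subalgebra E `<=` DN `&` P by move/(_ n En) => [].
  apply: generated_min => [|e Ee].
    by apply: leibniz_subalgebraI => // *; apply: PBr.
  by split; [rewrite DNE; apply: sub_generated | apply: EP].
have SDN_X e x : DN e -> X x -> S (q e x).
  move=> De Xx; move: e De; apply: indDN => [|e Ee|e e' De De'].
  - exact: (linear_subspace_preiml _ qB SL).
  - exact: Sex.
  - by rewrite /= q_brl; apply: linear_subspaceB => //; [apply: Sp|apply: Sq].
have SDN_M e m : DN e -> S (q e m).
  move: m e; apply: indM => [|x Xx e De|m m' Sm Sm' e De].
  - split=> [e _ | k m m' Sm Sm' e De].
      by rewrite bilinear0r //; case: SL.
    by rewrite !(bilinE qB); apply: SL.2; [apply: Sm | apply: Sm'].
  - exact: SDN_X.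
  - by rewrite q_brr; apply: linear_subspaceB => //; [apply: Sm'|apply: Sm].
have SX_DN x e : X x -> DN e -> S (p x e).
  move=> Xx; move: e; apply: indDN => [|e Ee|e e' De De'].
  - exact: (linear_subspace_preimr _ pB SL).
  - exact: Sxe.
  - by rewrite /= p_brr; apply: linear_subspaceB => //; apply: Sp.
have SM_DN m e : DN e -> S (p m e).
  move: m e; apply: indM => [|x Xx e De|m m' Sm Sm' e De].
  - split=> [e _ | k m m' Sm Sm' e De].
      by rewrite bilinear0l //; case: SL.
    by rewrite !(bilinE pB); apply: SL.2; [apply: Sm | apply: Sm'].
  - exact: SX_DN.
  - rewrite p_brl; apply: linear_subspaceB => //; first exact: SDN_M.
    exact: Sm.
have SM_Y m y : Y y -> S (p m y).
  move=> Yy; move: m; apply: indM => [|x Xx|m m' _ _].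
  - exact: (linear_subspace_preiml _ pB SL).
  - exact: Sxy.
  - rewrite /= p_brl; apply: linear_subspaceB => //; first exact: SDN_M.
    exact: SM_DN.
move=> m n; move: n m; apply: indN => [|y Yy m|n n' Sn Sn' m].
- split=> [m | k n n' Sn Sn' m]; first by rewrite bilinear0r //; case: SL.
  by rewrite !(bilinE pB); apply: SL.2.
- exact: SM_Y.
- by rewrite p_brr; apply: linear_subspaceB.
Qed.

(** * The bracket of the tensor product *)

Section TensorBracket.
Variables (K : fieldType) (M N : leibnizType K).
Variables (a : leibniz_action M N) (b : leibniz_action N M).
Local Notation T := (tensor a b).
Local Notation mn := (tensor_mn a b).
Local Notation nm := (tensor_nm a b).

Lemma tensor_pairing : crossed_pairing a b mn nm.
Proof.
have rel x y : tensor_rel a b x y ->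
  pres_class (tensor_rel a b) x = pres_class (tensor_rel a b) y.
  exact: pres_rel.
rewrite /tensor_mn /tensor_nm /pres_gen; split.
- split=> [n k m m' | m k n n'] /=.
    by rewrite (rel _ _ (tr_add_mn_l _ _ _ _ _)) pres_classD
      -(rel _ _ (tr_scale_mn_l _ _ _ _ _)) pres_classZ.
  by rewrite (rel _ _ (tr_add_mn_r _ _ _ _ _)) pres_classD
    -(rel _ _ (tr_scale_mn_r _ _ _ _ _)) pres_classZ.
- split=> [m k n n' | n k m m'] /=.
    by rewrite (rel _ _ (tr_add_nm_l _ _ _ _ _)) pres_classD
      -(rel _ _ (tr_scale_nm_l _ _ _ _ _)) pres_classZ.
  by rewrite (rel _ _ (tr_add_nm_r _ _ _ _ _)) pres_classD
    -(rel _ _ (tr_scale_nm_r _ _ _ _ _)) pres_classZ.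
- by move=> m n n'; rewrite (rel _ _ (tr_br_mn_r _ _ _ _ _)) pres_classD
    pres_classN.
- by move=> m m' n; rewrite (rel _ _ (tr_br_nm_r _ _ _ _ _)) pres_classD
    pres_classN.
- by move=> m m' n; rewrite (rel _ _ (tr_br_mn_l _ _ _ _ _)) pres_classD
    pres_classN.
- by move=> m n n'; rewrite (rel _ _ (tr_br_nm_l _ _ _ _ _)) pres_classD
    pres_classN.
Qed.

Lemma tensor_ind (S : set T) :
  leibniz_subalgebra S ->
  (forall m n, S (mn m n)) -> (forall n m, S (nm n m)) -> forall t, S t.
Proof.
move=> [S0 SD SB] Smn Snm t; rewrite -[t]pres_reprK.
have SZ k x : S x -> S (k *: x) by move=> Sx; rewrite -[_ *: _]addr0; apply: SD.
elim: (pres_repr t) => [[m n|n m]||x Sx y Sy|x Sx|k x Sx|x Sx y Sy].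
- exact: Smn.
- exact: Snm.
- exact: S0.
- by rewrite pres_classD -[pres_class _ x]scale1r; apply: SD.
- by rewrite pres_classN -scaleN1r; apply: SZ.
- by rewrite pres_classZ; apply: SZ.
- by rewrite pres_class_br; apply: SB.
Qed.

Definition tensor_symbols : set T := range (pres_gen (tensor_rel a b)).

Lemma br_symbol_mn g g' :
  [< pres_gen (tensor_rel a b) g, pres_gen (tensor_rel a b) g' >] =
  mn (tau_M_symbol b g) (tau_N_symbol a g').
Proof.
rewrite /tensor_mn /pres_gen -pres_class_br.
by case: g g' => [m n|n m] [m' n'|n' m'] /=; apply/esym/pres_rel; constructor.
Qed.

Lemma br_symbol_nm g g' :
  [< pres_gen (tensor_rel a b) g, pres_gen (tensor_rel a b) g' >] =
  nm (tau_N_symbol a g) (tau_M_symbol b g').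
Proof.
rewrite /tensor_nm /pres_gen -pres_class_br.
by case: g g' => [m n|n m] [m' n'|n' m'] /=; apply/pres_rel; constructor.
Qed.

(** The bracket of two symbols is again a symbol, so the linear span of the
symbols is already a subalgebra. *)
Lemma tensor_span (t : T) : linear_span tensor_symbols t.
Proof.
have sub g : linear_span tensor_symbols (pres_gen (tensor_rel a b) g).
  by move=> S [_]; apply; exists g.
apply: tensor_ind => [|m n|n m]; try exact: sub.
apply: linear_span_subalgebra => _ _ [g _ <-] [g' _ <-].
by rewrite br_symbol_mn; apply: sub.
Qed.

Hypothesis ab : compatible a b.
Local Notation tM := (tau_M ab).
Local Notation tN := (tau_N ab).

Lemma tensor_br_mn (t t' : T) : [< t, t' >] = mn (tM t) (tN t').
Proof.
have [pB _ _ _ _ _] := tensor_pairing.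
have [tML _] := tau_M_morphism ab; have [tNL _] := tau_N_morphism ab.
move: (tensor_span t) (tensor_span t'); move: t t'.
apply: (@bilinear_eq_span K T T T lbr (fun t t' => mn (tM t) (tN t'))).
- exact: lbr_bilinear.
- by split=> [v k u w|u k v w] /=; rewrite ?tML ?tNL !(bilinE pB).
- move=> _ _ [g _ <-] [g' _ <-].
  by rewrite br_symbol_mn /tau_M /tau_N !pres_lift_gen.
Qed.

Lemma tensor_br_nm (t t' : T) : [< t, t' >] = nm (tN t) (tM t').
Proof.
have [_ qB _ _ _ _] := tensor_pairing.
have [tML _] := tau_M_morphism ab; have [tNL _] := tau_N_morphism ab.
move: (tensor_span t) (tensor_span t'); move: t t'.
apply: (@bilinear_eq_span K T T T lbr (fun t t' => nm (tN t) (tM t'))).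
- exact: lbr_bilinear.
- by split=> [v k u w|u k v w] /=; rewrite ?tML ?tNL !(bilinE qB).
- move=> _ _ [g _ <-] [g' _ <-].
  by rewrite br_symbol_nm /tau_M /tau_N !pres_lift_gen.
Qed.

(** Both arguments may be moved into [S] along the kernel of [tau_M], which is
central: the first through [tensor_br_mn], the second through [tensor_br_nm]. *)
Lemma sub_tensor_br (S : set T) :
  leibniz_subalgebra S -> range tM `<=` tM @` S ->
  forall t t' : T, S [< t, t' >].
Proof.
move=> [_ _ SB] tMS t t'.
have [s Ss st] := tMS _ (imageT tM t).
have [s' Ss' st'] := tMS _ (imageT tM t').
by rewrite tensor_br_mn -st -tensor_br_mn tensor_br_nm -st' -tensor_br_nm;
  apply: SB.
Qed.

End TensorBracket.

(** * Finite generation of the tensor product *)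

Theorem theorem2p5 (K : fieldType) (M N : leibnizType K)
    (a : leibniz_action M N) (b : leibniz_action N M)
    (ab : compatible a b) :
  finitely_generated [set: M] -> finitely_generated [set: N] ->
  (finitely_generated [set: tensor a b] <->
   finitely_generated (range (tau_M ab)) /\
   finitely_generated (range (tau_N ab))).
Proof.
move=> [X MX] [Y NY]; split=> [Tfg | [DMfg DNfg]].
  by split; apply: image_finitely_generated => //;
    [apply: tau_M_morphism | apply: tau_N_morphism].
have [r rP] := finitely_generated_lift (tau_M_morphism ab) DMfg.
have [D DME] := DMfg; have [E DNE] := DNfg.
pose mn := tensor_mn a b; pose nm := tensor_nm a b.
(* [r] maps onto [DM]; of the six families of symbols, the first three serve
[M * N] and the last three serve [N * M]. *)
exists (r ++ [seq nm e x | e <- E, x <- X] ++ [seq mn x e | x <- X, e <- E]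
  ++ [seq mn x y | x <- X, y <- Y] ++ [seq mn d y | d <- D, y <- Y]
  ++ [seq nm y d | y <- Y, d <- D] ++ [seq nm y x | y <- Y, x <- X]).
set s := (X in [set` X]); set S := generated_subalgebra _.
have SL : leibniz_subalgebra S by apply: generated_subalgebraP.
have sS t : t \in s -> S t by move=> ts; apply: sub_generated.
have Sbr : forall t t', S [< t, t' >].
  apply: (sub_tensor_br (ab := ab)) => //; apply: rP => // t tr.
  by apply: sS; rewrite mem_cat [_ \in r]tr.
have SDmn m n : range (tau_M ab) m -> range (tau_N ab) n -> S (mn m n).
  by move=> [t _ <-] [t' _ <-]; rewrite /mn -tensor_br_mn; apply: Sbr.
have SDnm m n : range (tau_M ab) m -> range (tau_N ab) n -> S (nm n m).
  by move=> [t _ <-] [t' _ <-]; rewrite /nm -tensor_br_nm; apply: Sbr.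
have DMl n m : range (tau_M ab) (actl b n m)
  by rewrite -(tau_M_nm ab); apply: imageT.
have DMr m n : range (tau_M ab) (actr b m n)
  by rewrite -(tau_M_mn ab); apply: imageT.
have DNl m n : range (tau_N ab) (actl a m n)
  by rewrite -(tau_N_mn ab); apply: imageT.
have DNr n m : range (tau_N ab) (actr a n m)
  by rewrite -(tau_N_nm ab); apply: imageT.
have SLin := leibniz_subalgebra_linear SL; have pair := tensor_pairing a b.
rewrite eqEsubset; split=> // t _; move: t.
apply: tensor_ind => // [m n|n m].
  apply: (pairing_generated pair SLin DMl DMr DNl DNr SDmn SDnm MX NY DNE)
    => [e x|x e|x y] /= h h'; apply: sS; rewrite !mem_cat.
  - by rewrite (allpairs_f nm h h') ?orbT.
  - by rewrite (allpairs_f mn h h') ?orbT.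
  - by rewrite (allpairs_f mn h h') ?orbT.
apply: (pairing_generated (crossed_pairing_swap pair) SLin DNl DNr DMl DMr
  (fun n m Dn Dm => SDnm m n Dm Dn) (fun n m Dn Dm => SDmn m n Dm Dn) NY MX DME)
  => [d y|y d|y x] /= h h'; apply: sS; rewrite !mem_cat.
- by rewrite (allpairs_f mn h h') ?orbT.
- by rewrite (allpairs_f nm h h') ?orbT.
- by rewrite (allpairs_f nm h h') ?orbT.
Qed.
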